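(* Let $y = X\beta + \sigma\varepsilon$ be the Gaussian linear regression model with $n$ observations and $p < n$ explanatory variables, let $S^\star \subseteq \{1,\ldots,p\}$ be the set of indices of the truly non-zero coefficients (i.e. $\beta_i \neq 0$ for $i \in S^\star$ and $\beta_i = 0$ for $i \notin S^\star$), and let $\hat S \subseteq \{1,\ldots,p\}$ be a subset chosen from the data by minimizing $$\gamma_n(S) = n \log \mathrm{SSE}(S) + c_n |S|$$ over all $S \subseteq \{1,\ldots,p\}$, where $\mathrm{SSE}(S)$ is the least squares error sum of squares of the sub-model using only the explanatory variables in $S$. Suppose that $\hat S \supset S^\star$ (strict containment). Put $$a_n = \frac{c_n}{n}\,(n - |S^\star| - 1), \qquad D_n = \frac{|\hat S| - |S^\star|}{n - |S^\star| - 1}.$$ If $$1 - \exp(-a_n D_n) > D_n,$$ then $\hat\sigma_{\hat S} < \hat\sigma_{S^\star}$, where $\hat\sigma_S$ denotes the least squares estimator of the error standard deviation in the sub-model corresponding to $S$, i.e. $\hat\sigma_S \ge 0$ and $\hat\sigma_S^2 = \mathrm{SSE}(S)/(n - |S| - 1)$.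
   Context: Model: $y$ is an $n$-vector of responses, $X$ is an $n \times p$ matrix of explanatory variables with $p < n$, $\beta \in \mathbb{R}^p$ is the vector of slope coefficients, $\sigma > 0$, and $\varepsilon$ is an $n$-vector of independent Gaussian noise. The vector $y$ and the columns of $X$ are centered, so that the intercept term can be ignored (this is the reason for the extra $-1$ in the degrees of freedom). The matrix $X$ has full column rank. For $S \subseteq \{1,\ldots,p\}$, $|S|$ is its cardinality, $X_S$ is the matrix consisting of the columns of $X$ with indices in $S$, $\hat\beta_S$ is the least squares estimator obtained by regressing $y$ on $X_S$, and $\mathrm{SSE}(S) = \|y - X_S\hat\beta_S\|^2$ (for $S = \emptyset$, $\mathrm{SSE}(\emptyset) = \|y\|^2$). It is understood that these error sums of squares are positive, so that the logarithms in $\gamma_n$ are defined. The variance estimator is $\hat\sigma_S^2 = \mathrm{SSE}(S)/(n-|S|-1)$. The $c_n$ form a user-specified sequence of constants with $c_n = o(n)$; for example $c_n \equiv 2$ gives the Akaike information criterion (AIC) and $c_n = \log n$ the Bayesian information criterion (BIC). The statement is for the given $n$ and the realized data: it concerns any data set for which the selected set $\hat S$ strictly contains $S^\star$ and the displayed inequality holds. The estimators $\hat\beta_{S^\star}, \hat\sigma_{S^\star}$ are called oracle estimators. *)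

(* Defs.v *)
From HB Require Import structures.
From mathcomp Require Import all_boot all_order all_algebra.
From mathcomp Require Import all_classical all_reals all_analysis.

Set Implicit Arguments.
Unset Strict Implicit.
Unset Printing Implicit Defensive.

Import Order.TTheory GRing.Theory Num.Theory.
Import numFieldNormedType.Exports.

Local Open Scope classical_set_scope.
Local Open Scope ring_scope.

(* Taking [A i = setT] outside a subfamily recovers the product rule for every
   subfamily. *)
Definition mutually_independent d (T : measurableType d) (R : realType)
    (P : probability T R) n (Z : 'I_n -> {RV P >-> R}) : Prop :=
  forall A : 'I_n -> set R, (forall i, measurable (A i)) ->
    P (\bigcap_(i in [set: 'I_n]) (Z i @^-1` A i)) =
    (\prod_(i < n) P (Z i @^-1` A i))%E.

Definition standard_gaussian_noise d (T : measurableType d) (R : realType)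
    (P : probability T R) n (eps : 'I_n -> {RV P >-> R}) : Prop :=
  mutually_independent eps /\
  forall (i : 'I_n) (A : set R), measurable A ->
    distribution P (eps i) A = normal_prob 0 1 A.

Definition centered_cols (R : realType) n m (A : 'M[R]_(n, m)) : Prop :=
  forall j, \sum_(i < n) A i j = 0.

(* The squared Euclidean norm; the library norm on matrices is the max norm. *)
Definition sqnorm (R : realType) n (v : 'cV[R]_n) : R :=
  \sum_(i < n) v i 0 ^+ 2.

Definition is_least_squares (R : realType) n m (A : 'M[R]_(n, m))
    (y : 'cV[R]_n) (b : 'cV[R]_m) : Prop :=
  forall b' : 'cV[R]_m, sqnorm (y - A *m b) <= sqnorm (y - A *m b').

(* The default value 0 of [xget] is not used: by [least_squaresP] and
   [least_squares_uniq] the minimizer exists and is unique when A has full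
   column rank, which [rank_subcols] gives for the submatrices of X. *)
Definition least_squares (R : realType) n m (A : 'M[R]_(n, m))
    (y : 'cV[R]_n) : 'cV[R]_m :=
  xget 0 [set b | is_least_squares A y b].

Definition subcols (R : realType) n p (X : 'M[R]_(n, p)) (S : {set 'I_p}) :
    'M[R]_(n, #|S|) :=
  colsub (fun k : 'I_#|S| => enum_val k) X.

Definition SSE (R : realType) n p (X : 'M[R]_(n, p)) (y : 'cV[R]_n)
    (S : {set 'I_p}) : R :=
  sqnorm (y - subcols X S *m least_squares (subcols X S) y).

Definition gamma_crit (R : realType) (c : nat -> R) n p (X : 'M[R]_(n, p))
    (y : 'cV[R]_n) (S : {set 'I_p}) : R :=
  n%:R * ln (SSE X y S) + c n * #|S|%:R.

(* The subtractions are in R, not truncated; the extra -1 accounts for the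
   intercept removed by centering. *)
Definition sigma_hat (R : realType) n p (X : 'M[R]_(n, p)) (y : 'cV[R]_n)
    (S : {set 'I_p}) : R :=
  Num.sqrt (SSE X y S / (n%:R - #|S|%:R - 1)).

Section LeastSquares.
Variables (R : realType) (n m : nat) (A : 'M[R]_(n, m)) (y : 'cV[R]_n).

Lemma sqnormE k (v : 'cV[R]_k) : sqnorm v = (v^T *m v) 0 0.
Proof. by rewrite mxE; apply: eq_bigr => i _; rewrite mxE expr2. Qed.

Lemma sqnorm_eq0 k (v : 'cV[R]_k) : sqnorm v = 0 -> v = 0.
Proof.
move/eqP; rewrite /sqnorm psumr_eq0 => [/allP v0|i _]; last exact: sqr_ge0.
apply/matrixP => i j; rewrite ord1 mxE; apply/eqP.
by rewrite -sqrf_eq0; apply: (v0 i); rewrite mem_index_enum.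
Qed.

Lemma sqnorm_ge0 k (v : 'cV[R]_k) : 0 <= sqnorm v.
Proof. by apply: sumr_ge0 => i _; exact: sqr_ge0. Qed.

Hypothesis rkA : \rank A = m.

Lemma full_col_rank_inj (v : 'cV[R]_m) : A *m v = 0 -> v = 0.
Proof.
move=> Av0; apply: trmx_inj; rewrite trmx0; apply/eqP.
have fA : row_free A^T by rewrite /row_free mxrank_tr rkA.
by rewrite -(mulmx_free_eq0 _ fA) -trmx_mul Av0 trmx0.
Qed.

Lemma gram_unit : A^T *m A \in unitmx.
Proof.
rewrite -row_free_unit -kermx_eq0; apply/rowV0P => v /sub_kermxP vG0.
apply: trmx_inj; rewrite trmx0; apply: full_col_rank_inj.
by apply: sqnorm_eq0; rewrite sqnormE trmx_mul trmxK mulmxA -(mulmxA v) vG0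
  mul0mx mxE.
Qed.

Let b0 := invmx (A^T *m A) *m (A^T *m y).

Lemma sqnorm_residual (b : 'cV[R]_m) :
  sqnorm (y - A *m b) = sqnorm (y - A *m b0) + sqnorm (A *m (b0 - b)).
Proof.
have nrm : A^T *m (y - A *m b0) = 0.
  by rewrite mulmxBr !mulmxA mulmxV ?gram_unit// mul1mx subrr.
have -> : y - A *m b = (y - A *m b0) + A *m (b0 - b).
  by rewrite mulmxBr addrA subrK.
move: (y - A *m b0) (b0 - b) nrm => r w nrm.
have rA0 : r^T *m (A *m w) = 0.
  by rewrite mulmxA -[r^T *m A]trmxK trmx_mul trmxK nrm trmx0 mul0mx.
rewrite !sqnormE [(r + _)^T]linearD/= mulmxDl !mulmxDr rA0 addr0.
by rewrite [(A *m w)^T]trmx_mul -[w^T *m A^T *m r]mulmxA nrm mulmx0 add0r mxE.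
Qed.

Lemma least_squaresP : is_least_squares A y (least_squares A y).
Proof.
apply: (@xgetPex _ 0 [set b | is_least_squares A y b]).
exists b0 => b'; rewrite [leRHS]sqnorm_residual lerDl; exact: sqnorm_ge0.
Qed.

Lemma least_squares_uniq b : is_least_squares A y b -> b = b0.
Proof.
move=> /(_ b0); rewrite sqnorm_residual gerDl => le0.
apply/esym/eqP; rewrite -subr_eq0; apply/eqP.
apply/full_col_rank_inj/sqnorm_eq0/eqP.
by rewrite eq_le le0 sqnorm_ge0.
Qed.

End LeastSquares.

Lemma rank_subcols (R : realType) n p (X : 'M[R]_(n, p)) (S : {set 'I_p}) :
  \rank X = p -> \rank (subcols X S) = #|S|.
Proof.
move=> rkX; have /row_freeP[B XB] : row_free X^T.
  by rewrite /row_free mxrank_tr rkX.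
rewrite -mxrank_tr; apply/eqP/row_freeP.
exists (B *m colsub (fun k : 'I_#|S| => enum_val k) 1%:M).
apply/matrixP => i j.
have -> : (subcols X S)^T = rowsub (fun k : 'I_#|S| => enum_val k) X^T.
  by apply/matrixP => ? ?; rewrite !mxE.
rewrite mul_rowsub_mx mulmxA XB mul1mx !mxE.
by rewrite (inj_eq enum_val_inj).
Qed.

(* Main.v *)
Require Import Defs.
From HB Require Import structures.
From mathcomp Require Import all_boot all_order all_algebra.
From mathcomp Require Import all_classical all_reals all_analysis.
From mathcomp Require Import ring lra.

Import Order.TTheory GRing.Theory Num.Theory.
Import numFieldNormedType.Exports.

Local Open Scope classical_set_scope.
Local Open Scope ring_scope.

(** The variance estimate drops once the error sum of squares shrinks by a smaller factor than the
    degrees of freedom do. Minimality is used only against [Sstar]; the penalty gap there is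
    [n * (a * D)], so exponentiating bounds the first factor by [expR (- (a * D))]. *)

(* Minimality of [gamma_crit] at [Shat] gives
   SSE(Shat) <= SSE(Sstar) exp(- a D) < SSE(Sstar) (1 - D), and 1 - D is exactly
   the ratio of the degrees of freedom of [Shat] and [Sstar]. *)
Theorem theorem1 (R : realType)
  (d : measure_display) (T : measurableType d) (P : probability T R)
  (n p : nat) (hpn : (p < n)%N)
  (X : 'M[R]_(n, p)) (hXrank : \rank X = p) (hXcentered : centered_cols X)
  (beta : 'cV[R]_p) (sigma : R) (hsigma : 0 < sigma)
  (eps : 'I_n -> {RV P >-> R}) (heps : standard_gaussian_noise eps)
  (omega : T) (y : 'cV[R]_n)
  (hy : y = X *m beta + sigma *: (\col_(i < n) eps i omega))
  (hycentered : centered_cols y)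
  (hSSE : forall S : {set 'I_p}, 0 < SSE X y S)
  (c : nat -> R) (hc : c =o_\oo (fun k : nat => k%:R : R))
  (Sstar : {set 'I_p}) (hSstar : forall i, (i \in Sstar) = (beta i 0 != 0))
  (Shat : {set 'I_p})
  (hShat : forall S : {set 'I_p}, gamma_crit c X y Shat <= gamma_crit c X y S)
  (hcontain : Sstar \proper Shat) :
  let a := c n / n%:R * (n%:R - #|Sstar|%:R - 1) in
  let D := (#|Shat|%:R - #|Sstar|%:R) / (n%:R - #|Sstar|%:R - 1) in
  D < 1 - expR (- (a * D)) ->
  sigma_hat X y Shat < sigma_hat X y Sstar.
Proof.
move=> a D hD.
have m_gt0 : 0 < n%:R - #|Sstar|%:R - 1 :> R.
  (* Strict containment absorbs the extra 1: [#|Sstar| + 1 <= #|Shat| <= p < n]. *)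
  rewrite -addrA -opprD subr_gt0 natr1 ltr_nat.
  apply: leq_ltn_trans (proper_card hcontain) _.
  by apply: leq_ltn_trans (max_card _) _; rewrite card_ord.
have n_gt0 : 0 < n%:R :> R by rewrite ltr0n; apply: leq_ltn_trans hpn.
have aDE : n%:R * (a * D) = c n * (#|Shat|%:R - #|Sstar|%:R).
  rewrite /a /D; field.
  by rewrite !lt0r_neq0.
have SSE_le : SSE X y Shat <= SSE X y Sstar * expR (- (a * D)).
  (* After taking logarithms and multiplying by [n], this is the criterion inequality rearranged. *)
  rewrite -ler_ln ?posrE ?mulr_gt0 ?expR_gt0 ?hSSE//.
  rewrite lnM ?posrE ?expR_gt0 ?hSSE// expRK -(ler_pM2l n_gt0).
  have := hShat Sstar; rewrite /gamma_crit mulrDr mulrN aDE; lra.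
have mD : (n%:R - #|Sstar|%:R - 1) * (1 - D) = n%:R - #|Shat|%:R - 1 :> R.
  by rewrite /D; field; rewrite lt0r_neq0.
have expD : expR (- (a * D)) < 1 - D by lra.
(* [D < 1], so the degrees of freedom of [Shat] do not vanish. *)
have D_lt1 : 0 < 1 - D by apply: lt_trans expD; exact: expR_gt0.
rewrite /sigma_hat ltr_sqrt ?divr_gt0// -mD.
(* Cancelling the common factor [n - #|Sstar| - 1] leaves
   [SSE X y Shat < SSE X y Sstar * (1 - D)]. *)
rewrite invfM mulrA mulrAC ltr_pM2r ?invr_gt0// ltr_pdivrMr//.
by apply: le_lt_trans SSE_le _; rewrite ltr_pM2l.
Qed.
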